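(* Let $n\ge1$ be an integer, let $R=\mathbb Q[a,b,c]$ be the polynomial ring in three indeterminates, and let $I=(a^n,ab,bc)\subset R$. Then the highest degree of an algebra generator of $A(I)$ is precisely $n$, i.e. $d(A(I))=n$. In particular, the highest degree of a generator of the symbolic power algebra of a monomial ideal of height $2$ may be arbitrarily large.
   Context: Symbolic powers: a monomial ideal $I\subset R$ has a unique irredundant presentation as an intersection of irreducible monomial ideals (ideals generated by powers of some of the variables). Intersecting those components having the same radical gives a canonical primary decomposition $I=\bigcap_i Q_i$ with pairwise distinct radicals, and the $k$th symbolic power of $I$ is $I^{(k)}=\bigcap_i Q_i^k$. The symbolic power algebra is $A(I)=\bigoplus_{k\ge0}I^{(k)}t^k\subset R[t]$, graded by the exponent of $t$, so that its degree-$0$ component is $R$; it is a finitely generated $R$-algebra. For a finitely generated graded $R$-algebra $A$, $d(A)$ denotes the highest degree of the minimal generators of $A$ as an $R$-algebra, i.e. the smallest integer $d$ such that $A$ is generated over $R$ by homogeneous elements of degree at most $d$. *)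

(* Defs.v *)
From HB Require Import structures.
From mathcomp Require Import all_boot all_order all_algebra.
From mathcomp Require Import boolp classical_sets.
From mathcomp Require Import mpoly.

Set Implicit Arguments.
Unset Strict Implicit.
Unset Printing Implicit Defensive.

Import GRing.Theory.

Local Open Scope classical_set_scope.
Local Open Scope ring_scope.

Section Ideals.
Variable R : comNzRingType.
Implicit Types (I J P : set R) (k h : nat).

(* The unit ideal is allowed here, in contrast with [idealr_closed], which
   requires [1 \notin I]. *)
Definition is_ideal I : Prop :=
  I 0 /\ forall a x y, I x -> I y -> I (a * x + y).

Definition ideal_gen (S : set R) : set R := smallest is_ideal S.

Definition ideal_mul I J : set R :=
  ideal_gen [set z | exists x y, [/\ I x, J y & z = x * y]].

Definition ideal_pow I k : set R := iter k (ideal_mul I) setT.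

Definition radical I : set R := [set x | exists k, I (x ^+ k)].

Definition prime_ideal P : Prop :=
  idealr_closed (mem P) /\ prime_idealr_closed (mem P).

Definition has_prime_chain P h : Prop :=
  exists p : nat -> set R,
    [/\ forall i, (i <= h)%N -> prime_ideal (p i),
        forall i, (i < h)%N -> p i `<` p i.+1
      & p h = P].

Definition prime_height P h : Prop :=
  has_prime_chain P h /\ forall k, has_prime_chain P k -> (k <= h)%N.

(* The minimum of the heights of the primes containing I; primes of infinite
   height have no [prime_height] and do not affect a finite minimum. *)
Definition ideal_height I h : Prop :=
  (exists P, [/\ prime_ideal P, I `<=` P & prime_height P h]) /\
  forall P k, prime_ideal P -> I `<=` P -> prime_height P k -> (h <= k)%N.

End Ideals.

Section MonomialIdeals.
Variables (K : fieldType) (n : nat).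
Implicit Types (I : set {mpoly K[n]}) (e : 'X_{1..n}) (E : seq 'X_{1..n}).

Definition monomial_ideal I : Prop :=
  exists M : set 'X_{1..n}, I = ideal_gen [set p | exists2 m, M m & p = 'X_[m]].

(* An irreducible monomial ideal is encoded by a vector e of exponents, where
   [e i = 0] means that no power of the i-th variable is a generator. *)
Definition irreducible_ideal e : set {mpoly K[n]} :=
  ideal_gen [set p | exists2 i : 'I_n, (0 < e i)%N & p = 'X_i ^+ e i].

Definition irreducible_meet E : set {mpoly K[n]} :=
  \bigcap_(e in [set e | e \in E]) irreducible_ideal e.

(* The order and the multiplicities of the members of E are irrelevant. *)
Definition irredundant_presentation I E : Prop :=
  I = irreducible_meet E /\
  forall E', {subset E' <= E} -> I = irreducible_meet E' -> {subset E <= E'}.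

(* The intersection of all the components with the same radical as that of e. *)
Definition primary_component E e : set {mpoly K[n]} :=
  \bigcap_(e' in [set e' | e' \in E /\
      radical (irreducible_ideal e') = radical (irreducible_ideal e)])
    irreducible_ideal e'.

(* Meaningful for monomial ideals I only: these have an irredundant
   presentation, unique up to order and repetitions. *)
Definition symbolic_power I (k : nat) : set {mpoly K[n]} :=
  [set f | exists2 E, irredundant_presentation I E &
     forall e, e \in E -> ideal_pow (primary_component E e) k f].

(* A(I), inside the polynomial ring in t over {mpoly K[n]}. *)
Definition symbolic_algebra I : set {poly {mpoly K[n]}} :=
  [set f | forall k, symbolic_power I k f`_k].

End MonomialIdeals.

Section GradedAlgebras.
Variable R : comNzRingType.
Implicit Types (A S : set {poly R}) (d : nat).

Definition subalgebra_gen S : set {poly R} :=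
  smallest (fun B => subalg_closed (mem B)) S.

Definition generated_in_degree_le A d : Prop :=
  exists S : set {poly R},
    (forall f, S f -> exists k (c : R), (k <= d)%N /\ f = c *: 'X^k) /\
    A = subalgebra_gen S.

Definition generation_degree A d : Prop :=
  generated_in_degree_le A d /\
  forall d', generated_in_degree_le A d' -> (d <= d')%N.

End GradedAlgebras.

(* Main.v *)
(** Since I = (a^n, b) ∩ (a, c), a monomial a^i b^j c^l lies in I^(k) exactly when
    k <= floor(i/n) + j and k <= i + l. For k > n such a monomial times t^k splits
    off bc t if i < n, and a^n b^(s-1) t^s with s = min(j, n-1) + 1 otherwise, so
    that degree n suffices. Conversely a^n b^(n-1) t^n cannot be split: the
    elements of A(I) in which it does not occur still form a subalgebra, which
    contains all the elements of degree less than n.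

    For the height, a chain of primes p_0 < ... < p_h and elements x_i of p_{i+1}
    outside p_i give a family x_0, ..., x_{h-1} that is algebraically independent
    modulo p_0. Counting monomials of bounded degree gives h <= 3. A chain ending
    at (a, b) extends to (a, b, c), so its length is at most 2. *)

Require Import Defs.
From HB Require Import structures.
From mathcomp Require Import all_boot all_order all_algebra.
From mathcomp Require Import boolp classical_sets.
From mathcomp Require Import mpoly zify.

Set Implicit Arguments.
Unset Strict Implicit.
Unset Printing Implicit Defensive.

Import GRing.Theory.

Local Open Scope classical_set_scope.
Local Open Scope ring_scope.

(** * Ideals and spans of monomials *)

Section IdealTheory.
Variable R : comNzRingType.
Implicit Types (I J : set R).

Lemma is_idealD I x y : is_ideal I -> I x -> I y -> I (x + y).
Proof. by case=> _ Il Ix Iy; rewrite -[x]mul1r; apply: Il. Qed.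

Lemma is_idealMl I a x : is_ideal I -> I x -> I (a * x).
Proof. by case=> I0 Il Ix; rewrite -[a * x]addr0; apply: Il. Qed.

Lemma is_idealMr I a x : is_ideal I -> I x -> I (x * a).
Proof. by rewrite mulrC; apply: is_idealMl. Qed.

Lemma is_ideal_sum I (T : eqType) (r : seq T) (F : T -> R) :
  is_ideal I -> {in r, forall i, I (F i)} -> I (\sum_(i <- r) F i).
Proof.
move=> idI IF; rewrite big_seq; elim/big_ind: _ => //; first by case: idI.
by move=> x y; apply: is_idealD.
Qed.

Lemma is_ideal_gen (S : set R) : is_ideal (ideal_gen S).
Proof.
split=> [|a x y Sx Sy] J [idJ SJ]; first by case: idJ.
by case: (idJ) => _; apply; [apply: Sx|apply: Sy].
Qed.

Lemma sub_ideal_gen (S : set R) : S `<=` ideal_gen S.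
Proof. exact: sub_gen_smallest. Qed.

Lemma ideal_gen_sub (S : set R) J :
  is_ideal J -> S `<=` J -> ideal_gen S `<=` J.
Proof. exact: smallest_sub. Qed.

Lemma prime_is_ideal I : prime_ideal I -> is_ideal I.
Proof.
case=> [[I0 _ Il] _]; split=> [|a x y Ix Iy]; first by rewrite inE in I0.
by have := Il a x y; rewrite !inE; apply.
Qed.

Lemma prime_ideal1 I : prime_ideal I -> ~ I 1.
Proof. by case=> [[_ /negP I1 _] _] J1; apply: I1; rewrite inE. Qed.

Lemma prime_idealM I x y : prime_ideal I -> I (x * y) -> I x \/ I y.
Proof.
case=> _ /(_ x y) Ip Ixy; have /orP[]: (x \in mem I) || (y \in mem I).
- by apply: Ip; rewrite inE.
- by rewrite inE; left.
- by rewrite inE; right.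
Qed.

Lemma prime_idealX I x k : prime_ideal I -> I (x ^+ k) -> I x.
Proof.
move=> pI; elim: k => [/(prime_ideal1 pI)//|k IHk].
by rewrite exprS => /(prime_idealM pI)[].
Qed.

Lemma prime_idealP I : is_ideal I -> ~ I 1 ->
  (forall x y, I (x * y) -> I x \/ I y) -> prime_ideal I.
Proof.
move=> [I0 Il] I1 Ip; split; first split.
- by rewrite inE.
- by apply/negP; rewrite inE.
- by move=> a x y; rewrite !inE; apply: Il.
by move=> x y; rewrite !inE => /Ip[Iz|Iz]; apply/orP; [left|right]; rewrite inE.
Qed.

End IdealTheory.

Section MonomialSpan.
Variables (K : fieldType) (n : nat).
Implicit Types (P : pred 'X_{1..n}) (e m : 'X_{1..n}) (f : {mpoly K[n]}).

(** The monomial ideals below are brought to this form, with [P] closed upwards, so that statements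
    about them become conditions on exponents. *)
Definition monomial_span P : set {mpoly K[n]} :=
  [set f | {subset msupp f <= P}].

Definition up_closed P := forall m m', P m -> P (m' + m)%MM.

Lemma monomial_spanX P m : monomial_span P 'X_[m] <-> P m.
Proof.
split=> [/(_ m)|Pm m']; first by rewrite msuppX mem_seq1 eqxx; apply.
by rewrite msuppX mem_seq1 => /eqP->.
Qed.

Lemma monomial_span0 P : monomial_span P 0.
Proof. by move=> m; rewrite msupp0. Qed.

Lemma monomial_spanD P f g :
  monomial_span P f -> monomial_span P g -> monomial_span P (f + g).
Proof. by move=> Pf Pg m /msuppD_le; rewrite mem_cat => /orP[/Pf|/Pg]. Qed.

Lemma monomial_span_mul P1 P2 P f g :
    (forall m1 m2, P1 m1 -> P2 m2 -> P (m1 + m2)%MM) ->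
  monomial_span P1 f -> monomial_span P2 g -> monomial_span P (f * g).
Proof.
move=> P12 P1f P2g m /msuppM_le/allpairsP[[m1 m2] /= [/P1f ? /P2g ? ->]].
exact: P12.
Qed.

Lemma monomial_span_ideal P : up_closed P -> is_ideal (monomial_span P).
Proof.
move=> upP; split=> [|a f g Pf Pg]; first exact: monomial_span0.
apply: monomial_spanD => //.
by apply: (@monomial_span_mul xpredT P) => // m1 m2 _; apply: upP.
Qed.

Lemma monomial_span_sub P (J : set {mpoly K[n]}) :
  is_ideal J -> (forall m, P m -> J 'X_[m]) -> monomial_span P `<=` J.
Proof.
move=> idJ PJ f Pf; rewrite [f]mpolyE; apply: is_ideal_sum => // m /Pf Pm.
by rewrite -mul_mpolyC; apply: is_idealMl => //; apply: PJ.
Qed.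

Lemma ideal_gen_monomialE P (S : set {mpoly K[n]}) : up_closed P ->
  S `<=` monomial_span P -> (forall m, P m -> ideal_gen S 'X_[m]) ->
  ideal_gen S = monomial_span P.
Proof.
move=> upP SP PS; apply/seteqP; split.
  by apply: ideal_gen_sub => //; apply: monomial_span_ideal.
by apply: monomial_span_sub => //; apply: is_ideal_gen.
Qed.

(* When e i = 0 the summand vanishes, as division by zero yields 0. *)
Definition irr_order (e m : 'X_{1..n}) := (\sum_i m i %/ e i)%N.

Lemma irr_orderD e m m' :
  (irr_order e m + irr_order e m' <= irr_order e (m + m')%MM)%N.
Proof.
rewrite -big_split /=; apply: leq_sum => i _.
rewrite mnmDE; case: (posnP (e i)) => [->|ei]; first by rewrite !divn0.
by rewrite [in leqRHS]divnD // leq_addr.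
Qed.

Lemma irr_order_gt0 e m :
  reflect (exists2 i, (0 < e i)%N & (e i <= m i)%N) (0 < irr_order e m)%N.
Proof.
apply: (iffP idP) => [|[i ei mi]].
  rewrite lt0n sum_nat_eq0 negb_forall => /existsP[i] /=; rewrite -lt0n => mei.
  have ei: (0 < e i)%N.
    by rewrite lt0n; apply: contraTneq mei => ->; rewrite divn0.
  by exists i => //; rewrite divn_gt0 in mei.
by rewrite /irr_order (bigD1 i) //= ltn_addr // divn_gt0.
Qed.

Lemma irr_order_up e k : up_closed (fun m => (k <= irr_order e m)%N).
Proof.
move=> m m' km; apply: leq_trans km _; apply: leq_trans (irr_orderD _ _ _).
exact: leq_addl.
Qed.

(** Dividing by one generator [X_i^(e i)] lowers the [i]-th quotient by one and leaves the others
    unchanged. *)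
Lemma irr_order_split e m k : (k < irr_order e m)%N ->
  exists i, [/\ (0 < e i)%N, (U_(i) *+ e i <= m)%MM
              & (k <= irr_order e (m - U_(i) *+ e i)%MM)%N].
Proof.
move=> km; have /irr_order_gt0[i ei mi] := leq_ltn_trans (leq0n k) km.
have le_m: (U_(i) *+ e i <= m)%MM.
  apply/mnm_lepP => j; rewrite mulmnE mnm1E; case: eqVneq => [<-|_] //.
  by rewrite mul1n.
exists i; split=> //; rewrite -ltnS; apply: (leq_trans km).
rewrite /irr_order (bigD1 i) // [in leqRHS](bigD1 i) //= mnmBE mulmnE mnm1E.
rewrite eqxx mul1n -{1}(subnK mi) divnDr // divnn ei addn1 !addSn ltnS.
rewrite leq_add2l; apply: leq_sum => j ij.
by rewrite mnmBE mulmnE mnm1E eq_sym (negPf ij) subn0.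
Qed.

Lemma irreducible_idealE e :
  irreducible_ideal e =
    monomial_span (fun m => 0 < irr_order e m)%N :> set {mpoly K[n]}.
Proof.
apply: ideal_gen_monomialE; first exact: irr_order_up.
  move=> _ [i ei ->]; rewrite mpolyXn; apply/monomial_spanX/irr_order_gt0.
  by exists i => //; rewrite mulmnE mnm1E eqxx mul1n.
move=> m /irr_order_split[i [ei le_m _]].
rewrite -(submK le_m) mpolyXD; apply: (is_idealMl _ (is_ideal_gen _)).
by apply: sub_ideal_gen; exists i; rewrite // mpolyXn.
Qed.

(** [irr_order e m] counts the generators [X_i^(e i)] that can be split off [X^m] one after another.
    Superadditivity gives one inclusion; for the other, [irr_order_split] peels off one factor per
    induction step. *)
Lemma irreducible_ideal_powE e k :
  ideal_pow (irreducible_ideal e) k =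
    monomial_span (fun m => k <= irr_order e m)%N :> set {mpoly K[n]}.
Proof.
elim: k => [|k IHk]; first by apply/seteqP; split.
rewrite -[LHS]/(ideal_mul _ (ideal_pow _ k)) IHk.
apply: ideal_gen_monomialE; first exact: irr_order_up.
  rewrite irreducible_idealE => _ [f [g [ef eg ->]]].
  apply: monomial_span_mul ef eg => m1 m2 em1 em2.
  by apply: leq_trans (irr_orderD _ _ _); rewrite -add1n leq_add.
move=> m /irr_order_split[i [ei le_m km]].
rewrite -(submK le_m) mpolyXD mulrC; apply: sub_ideal_gen.
exists 'X_[U_(i) *+ e i], 'X_[m - U_(i) *+ e i]; split=> //.
  by apply: sub_ideal_gen; exists i; rewrite // mpolyXn.
by apply/monomial_spanX.
Qed.

Lemma irreducible_meetX (E : seq 'X_{1..n}) m :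
  irreducible_meet E ('X_[m] : {mpoly K[n]}) <->
    all (fun e => 0 < irr_order e m)%N E.
Proof.
split=> [Em|/allP Em e Ee].
  by apply/allP => e /Em; rewrite irreducible_idealE => /monomial_spanX.
by rewrite irreducible_idealE; apply/monomial_spanX/Em.
Qed.

(** The variables in the radical recover the support of [e], which is how components with different
    radicals are told apart. *)
Lemma radical_irreducibleX e i :
  radical (irreducible_ideal e) ('X_i : {mpoly K[n]}) <-> (0 < e i)%N.
Proof.
split=> [[k]|ei]; last by exists (e i); apply: sub_ideal_gen; exists i.
rewrite irreducible_idealE mpolyXn => /monomial_spanX/irr_order_gt0[j].
by rewrite mulmnE mnm1E; case: eqVneq => [->|_] // ej; rewrite leqNgt ej.
Qed.

End MonomialSpan.

(** * Graded algebras spanned by monomials *)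

Section GradedSpan.
Variables (K : fieldType) (n : nat).
Implicit Types (Q : nat -> pred 'X_{1..n}) (m : 'X_{1..n}).

Definition graded_span Q : set {poly {mpoly K[n]}} :=
  [set f | forall k, monomial_span (Q k) f`_k].

Lemma graded_span_scaleXn Q k c :
  monomial_span (Q k) c -> graded_span Q (c *: 'X^k).
Proof.
move=> Qc j; rewrite coefZ coefXn; case: eqVneq => [->|_].
  by rewrite mulr1.
by rewrite mulr0; apply: monomial_span0.
Qed.

(** All of [{mpoly K[n]}] acts by scalars in degree 0, whence the condition on [Q 0]. *)
Lemma graded_span_subalg Q : (forall m, Q 0%N m) ->
    (forall k l m m', Q k m -> Q l m' -> Q (k + l)%N (m + m')%MM) ->
  subalg_closed (mem (graded_span Q)).
Proof.
move=> Q0 QD; split=> [|c f g|f g]; rewrite ?inE.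
- rewrite -[1]scale1r -(expr0 'X).
  by apply: graded_span_scaleXn => m _; apply: Q0.
- move=> Qf Qg k; rewrite coefD coefZ; apply: monomial_spanD => //.
  by apply: (monomial_span_mul (P1 := Q 0%N) _ _ (Qf k)) => [m m'|m _];
    [apply: QD|apply: Q0].
move=> Qf Qg k; rewrite coefM; elim/big_ind: _ => [||i _].
- exact: monomial_span0.
- by move=> x y; apply: monomial_spanD.
apply: (monomial_span_mul _ (Qf i) (Qg (k - i)%N)) => m m' /QD /[apply].
by rewrite subnKC // -ltnS.
Qed.

Lemma graded_span_sub Q (B : set {poly {mpoly K[n]}}) :
    subalg_closed (mem B) ->
    (forall k m, Q k m -> B ('X_[m] *: 'X^k)) ->
  graded_span Q `<=` B.
Proof.
case=> [B1 Bl BM] QB f Qf.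
have B0 : 0 \in B by rewrite -(subrr 1) addrC -scaleN1r; apply: Bl.
have BD : {in B &, forall g h, g + h \in B}.
  by move=> g h Bg Bh; rewrite -[g]scale1r; apply: Bl.
have BZ c g : g \in B -> c *: g \in B.
  by move=> Bg; rewrite -[_ *: _]addr0; apply: Bl.
suff: f \in B by rewrite inE.
rewrite -[f]coefK poly_def; elim/big_ind: _ => // i _.
rewrite [f`_i]mpolyE scaler_suml big_seq; elim/big_ind: _ => // m /Qf Qm.
by rewrite -mul_mpolyC -scalerA BZ // inE; apply: QB.
Qed.

End GradedSpan.

(** * The ideal (a^n, ab, bc) *)

Section TwoComponents.
Variable K : fieldType.

Local Notation i0 := (@Ordinal 3 0 isT).
Local Notation i1 := (@Ordinal 3 1 isT).
Local Notation i2 := (@Ordinal 3 2 isT).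

Definition mnm3 (x y z : nat) : 'X_{1..3} :=
  [multinom nth 0%N [:: x; y; z] i | i < 3].

Lemma mnm3E x y z :
  (mnm3 x y z i0 = x) * (mnm3 x y z i1 = y) * (mnm3 x y z i2 = z).
Proof. by rewrite !mnmE. Qed.

Lemma mnm3P (m m' : 'X_{1..3}) :
  m i0 = m' i0 -> m i1 = m' i1 -> m i2 = m' i2 -> m = m'.
Proof.
move=> m0 m1 m2; apply/mnmP => -[[|[|[|//]]] lt_i].
- by rewrite (_ : Ordinal lt_i = i0) //; apply: val_inj.
- by rewrite (_ : Ordinal lt_i = i1) //; apply: val_inj.
- by rewrite (_ : Ordinal lt_i = i2) //; apply: val_inj.
Qed.

Lemma irr_order3 (e m : 'X_{1..3}) :
  irr_order e m = (m i0 %/ e i0 + m i1 %/ e i1 + m i2 %/ e i2)%N.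
Proof.
rewrite /irr_order !big_ord_recl big_ord0 addn0 addnA.
by congr (_ %/ _ + _ %/ _ + _ %/ _)%N; congr fun_of_multinom; apply: val_inj.
Qed.

Lemma irr_order3_gt0 (e m : 'X_{1..3}) :
  (0 < irr_order e m)%N =
    [|| (0 < e i0 <= m i0)%N, (0 < e i1 <= m i1)%N | (0 < e i2 <= m i2)%N].
Proof.
have gt0 d x : (0 < x %/ d)%N = (0 < d <= x)%N.
  by case: d => [|d]; rewrite ?divn0 // divn_gt0.
by rewrite irr_order3 !addn_gt0 !gt0 orbA.
Qed.

Section Ideal.
Variable n : nat.
Hypothesis n_gt0 : (0 < n)%N.

(** [e1] encodes [(a^n, b)] and [e2] encodes [(a, c)], the two components of the ideal. *)
Let e1 := mnm3 n 1 0.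
Let e2 := mnm3 1 0 1.

Definition abc_ideal : set {mpoly K[3]} :=
  ideal_gen [set 'X_i0 ^+ n; 'X_i0 * 'X_i1; 'X_i1 * 'X_i2].

Lemma abc_ideal_gensE :
  [set 'X_i0 ^+ n; 'X_i0 * 'X_i1; 'X_i1 * 'X_i2] =
  [set 'X_[mnm3 n 0 0]; 'X_[mnm3 1 1 0]; 'X_[mnm3 0 1 1]] :> set {mpoly K[3]}.
Proof.
rewrite mpolyXn -!mpolyXD.
rewrite (_ : U_(i0) *+ n = mnm3 n 0 0)%MM; last first.
  by apply: mnm3P; rewrite !mnm3E mulmnE mnm1E //= mul1n.
rewrite (_ : U_(i0) + U_(i1) = mnm3 1 1 0)%MM; last first.
  by apply: mnm3P; rewrite !mnm3E mnmDE !mnm1E.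
rewrite (_ : U_(i1) + U_(i2) = mnm3 0 1 1)%MM //.
by apply: mnm3P; rewrite !mnm3E mnmDE !mnm1E.
Qed.

Lemma abc_idealE : abc_ideal =
  monomial_span (fun m => (0 < irr_order e1 m) && (0 < irr_order e2 m))%N.
Proof.
rewrite /abc_ideal abc_ideal_gensE; apply: ideal_gen_monomialE.
- by move=> m m' /andP[m1 m2]; rewrite !(irr_order_up _).
- move=> _ [[|]|] ->; apply/monomial_spanX;
  by rewrite !irr_order3_gt0 !mnm3E /=; lia.
move=> m; rewrite !irr_order3_gt0 !mnm3E /= => hm.
have dvd (m0 : 'X_{1..3}) : (m0 i0 <= m i0)%N -> (m0 i1 <= m i1)%N ->
    (m0 i2 <= m i2)%N -> (m = m - m0 + m0)%MM.
  by move=> *; apply: mnm3P; rewrite mnmDE mnmBE subnK.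
(* If [a^n] does not divide the monomial, then [b] does; the generator to use is [bc] when [a] does
   not divide it, and [ab] otherwise. *)
have [mn|mn] := leqP n (m i0); last have [m0|m0] := posnP (m i0).
- rewrite (dvd (mnm3 n 0 0)) ?mnm3E // mpolyXD.
  by apply: (is_idealMl _ (is_ideal_gen _)); apply: sub_ideal_gen; left; left.
- rewrite (dvd (mnm3 0 1 1)) ?mnm3E; [|lia..].
  rewrite mpolyXD; apply: (is_idealMl _ (is_ideal_gen _)).
  by apply: sub_ideal_gen; right.
rewrite (dvd (mnm3 1 1 0)) ?mnm3E; [|lia..].
rewrite mpolyXD; apply: (is_idealMl _ (is_ideal_gen _)).
by apply: sub_ideal_gen; left; right.
Qed.

Lemma abc_idealX m : abc_ideal 'X_[m] <->
  (((n <= m i0) || (0 < m i1)) && ((0 < m i0) || (0 < m i2)))%N.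
Proof.
by rewrite abc_idealE; split=> [/monomial_spanX|?]; [|apply/monomial_spanX];
  rewrite !irr_order3_gt0 !mnm3E; lia.
Qed.

(** * Irreducible components and symbolic powers of the ideal *)

Lemma abc_ideal_meet : abc_ideal = irreducible_meet [:: e1; e2].
Proof.
rewrite abc_idealE; apply/seteqP; split=> [f fI e|f fE m mf].
  by rewrite /= !inE irreducible_idealE => /orP[]/eqP-> m /fI/andP[].
by apply/andP; split; [have := fE e1|have := fE e2];
  rewrite /= !inE eqxx ?orbT irreducible_idealE => /(_ isT m mf).
Qed.

(** Each of the two components is recognised as one that misses a suitable monomial outside the
    ideal. This yields both the irredundance of [[:: e1; e2]] and its uniqueness up to order and
    repetitions. *)
Lemma abc_ideal_components E : abc_ideal = irreducible_meet E ->
  e1 \in E /\ e2 \in E.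
Proof.
move=> IE; have IX m := abc_idealX m; rewrite IE in IX.
have {}IX m : all (fun e => 0 < irr_order e m)%N E =
    (((n <= m i0) || (0 < m i1)) && ((0 < m i0) || (0 < m i2)))%N.
  by apply/idP/idP => [mE|/IX/irreducible_meetX//]; apply/IX/irreducible_meetX.
(* Every component contains [a^n], [ab] and [bc]. *)
have eE (e : 'X_{1..3}) : e \in E -> [/\ (0 < e i0 <= n)%N,
    (e i0 == 1%N) || (e i1 == 1%N) & (e i1 == 1%N) || (e i2 == 1%N)].
  move=> Ee; have le m : _ -> (0 < irr_order e m)%N :=
    fun h => allP (etrans (IX m) h) _ Ee.
  have := le (mnm3 n 0 0); have := le (mnm3 1 1 0); have := le (mnm3 0 1 1).
  rewrite !irr_order3_gt0 !mnm3E; split; lia.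
(* With such a [C], the power [X_i^C] lies in every component that has a power of [X_i] among its
   generators. *)
have [C maxC] : exists C, forall (e : 'X_{1..3}) i, e \in E -> (e i <= C)%N.
  exists (\max_(e <- E) mdeg e) => e i Ee; rewrite (big_rem e) //=.
  by apply: leq_trans (leq_maxl _ _); rewrite mdegE (bigD1 i) //= leq_addr.
have exN m : all (fun e => 0 < irr_order e m)%N E = false ->
    exists2 e : 'X_{1..3}, e \in E & ~~ (0 < irr_order e m)%N.
  by move=> /negbT/allPn[e]; exists e.
split.
  (* A component missing [a^(n-1) c^C] has no power of [c] as a generator, and its power of [a] is
     [a^n]; then [eE] forces the exponent 1 at [b]. *)
  have [|e Ee] := exN (mnm3 n.-1 0 C); first by rewrite IX !mnm3E; lia.
  have := maxC e i2 Ee; have [] := eE e Ee; rewrite irr_order3_gt0 !mnm3E.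
  move=> ? ? ? ? ?; suff <- : e = e1 by [].
  by apply: mnm3P; rewrite !mnm3E; lia.
(* A component missing [b^C] has no power of [b] as a generator, so [eE] forces the exponent 1 at
   [a] and at [c]. *)
have [|e Ee] := exN (mnm3 0 C 0); first by rewrite IX !mnm3E; lia.
have := maxC e i1 Ee; have [] := eE e Ee; rewrite irr_order3_gt0 !mnm3E.
move=> ? ? ? ? ?; suff <- : e = e2 by [].
by apply: mnm3P; rewrite !mnm3E; lia.
Qed.

Lemma abc_ideal_irredundant : irredundant_presentation abc_ideal [:: e1; e2].
Proof.
split=> [|E' _ /abc_ideal_components[E1 E2] e]; first exact: abc_ideal_meet.
by rewrite !inE => /orP[]/eqP->.
Qed.

Lemma abc_ideal_presentation_sub E :
  irredundant_presentation abc_ideal E -> {subset E <= [:: e1; e2]}.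
Proof.
case=> /abc_ideal_components[E1 E2]; apply; last exact: abc_ideal_meet.
by move=> e; rewrite !inE => /orP[]/eqP->.
Qed.

(** The variable [b] lies in the radical of [(a^n, b)] but not in that of [(a, c)], so grouping by
    radicals merges nothing. *)
Lemma primary_component_e12 E e : {subset E <= [:: e1; e2]} -> e \in E ->
  primary_component E e = irreducible_ideal e :> set {mpoly K[3]}.
Proof.
move=> E12 Ee; apply/seteqP; split=> [f /(_ e)|f ef e' [Ee' rad_e']].
  by apply.
suff -> : e' = e by [].
have {rad_e'}: (0 < e' i1)%N <-> (0 < e i1)%N.
  by split=> /(@radical_irreducibleX K) ?; apply/(@radical_irreducibleX K);
    [rewrite -rad_e'|rewrite rad_e'].
have := E12 _ Ee; have := E12 _ Ee'; rewrite !inE.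
by move=> /orP[]/eqP-> /orP[]/eqP->; rewrite // !mnm3E => -[h1 h2];
  [have := h1 isT|have := h2 isT].
Qed.

Definition in_symbolic k (m : 'X_{1..3}) :=
  (k <= m i0 %/ n + m i1)%N && (k <= m i0 + m i2)%N.

(** Every irredundant presentation has exactly the members [e1] and [e2], so the choice of [E] in
    [symbolic_power] is immaterial and membership is read off from the two values of [irr_order]. *)
Lemma symbolic_powerE k :
  symbolic_power abc_ideal k = monomial_span (in_symbolic k).
Proof.
have w1 m : irr_order e1 m = (m i0 %/ n + m i1)%N.
  by rewrite irr_order3 !mnm3E divn1 divn0 addn0.
have w2 m : irr_order e2 m = (m i0 + m i2)%N.
  by rewrite irr_order3 !mnm3E !divn1 divn0 addn0.
apply/seteqP; split=> [f [E irrE fE] m mf|f fk].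
  have E12 := abc_ideal_presentation_sub irrE.
  have [Ee1 Ee2] := abc_ideal_components irrE.1.
  have := fE _ Ee1; have := fE _ Ee2.
  rewrite !primary_component_e12 // !irreducible_ideal_powE => /(_ m mf) m2.
  by move=> /(_ m mf) m1; rewrite unfold_in -w1 -w2; apply/andP.
exists [:: e1; e2] => [|e Ee]; first exact: abc_ideal_irredundant.
rewrite primary_component_e12 // irreducible_ideal_powE => m /fk.
rewrite unfold_in -w1 -w2 => /andP[].
by move: Ee; rewrite !inE => /orP[]/eqP->.
Qed.

Lemma symbolic_algebraE : symbolic_algebra abc_ideal = graded_span in_symbolic.
Proof.
by apply/seteqP; split=> f fP k; move: (fP k); rewrite symbolic_powerE.
Qed.

(** * Splitting monomials of the symbolic algebra, and its generation degree *)

Lemma in_symbolic0 m : in_symbolic 0 m.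
Proof. by []. Qed.

Lemma in_symbolicD k l m m' : in_symbolic k m -> in_symbolic l m' ->
  in_symbolic (k + l) (m + m')%MM.
Proof.
move=> /andP[m1 m2] /andP[m1' m2']; rewrite /in_symbolic !mnmDE divnD //.
by apply/andP; split; lia.
Qed.

Lemma in_symbolic_split k m : (n < k)%N -> in_symbolic k m ->
  exists s m1 m2, [/\ (0 < s <= n)%N, in_symbolic s m1, in_symbolic (k - s) m2
    & m = (m1 + m2)%MM].
Proof.
move=> nk /andP[]; set i := m i0; set j := m i1; set l := m i2 => k1 k2.
have [ni|ni] := leqP n i; last first.
  (* The quotient vanishes, so [k <= j]; moreover [l > 0] because [i < n < k <= i + l]. Hence [bc]
     divides the monomial. *)
  rewrite divn_small // add0n in k1.
  exists 1%N, (mnm3 0 1 1), (mnm3 i j.-1 l.-1); split=> //.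
  - by rewrite /in_symbolic !mnm3E div0n.
  - by rewrite /in_symbolic !mnm3E divn_small //; lia.
  - by apply: mnm3P; rewrite mnmDE !mnm3E -?/i -?/j -?/l; lia.
have := divn_eq i n; set q := (i %/ n)%N => iE.
have q_gt0 : (0 < q)%N by rewrite divn_gt0.
have iBn : ((i - n) %/ n = q.-1)%N.
  by rewrite /q -{2}(subnK ni) divnDr // divnn n_gt0 addn1.
have qn : (q.-1 <= i - n)%N by rewrite -iBn leq_div.
have [jn|jn] := leqP n.-1 j.
  exists n, (mnm3 n n.-1 0), (mnm3 (i - n) (j - n.-1) l); split.
  - by rewrite n_gt0 leqnn.
  - by rewrite /in_symbolic !mnm3E divnn n_gt0; lia.
  - by rewrite /in_symbolic !mnm3E iBn; lia.
  - by apply: mnm3P; rewrite mnmDE !mnm3E -?/i -?/j -?/l; lia.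
(* The first factor takes all of [b^j]. Since [j + 1 < n], the bound [k <= i + l] is too weak for
   the remainder, whose second condition comes from [k - (j + 1) <= q - 1 <= i - n]. *)
exists j.+1, (mnm3 n j 0), (mnm3 (i - n) 0 l); split.
- by lia.
- by rewrite /in_symbolic !mnm3E divnn n_gt0; lia.
- by rewrite /in_symbolic !mnm3E iBn; lia.
- by apply: mnm3P; rewrite mnmDE !mnm3E -?/i -?/j -?/l; lia.
Qed.

Let mu := mnm3 n n.-1 0.

Lemma in_symbolic_mu : in_symbolic n mu.
Proof. by rewrite /in_symbolic !mnm3E divnn n_gt0; lia. Qed.

(** If neither factor is divisible by [a^n], both quotients vanish and [k + l] is at most the
    exponent [n - 1] of [b], a contradiction. Otherwise the other factor is a power of [b], so it
    has degree 0 by the second condition, and the first condition in degree [n] claims all of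
    [b^(n-1)]. *)
Lemma in_symbolic_mu_irreducible k l m m' :
  in_symbolic k m -> in_symbolic l m' -> (k + l = n)%N -> (m + m' = mu)%MM ->
  (k = n /\ m = mu) \/ (l = n /\ m' = mu).
Proof.
move=> /andP[k1 k2] /andP[l1 l2] kl mE.
have E0 : (m i0 + m' i0 = n)%N by rewrite -mnmDE mE mnm3E.
have E1 : (m i1 + m' i1 = n.-1)%N by rewrite -mnmDE mE mnm3E.
have E2 : (m i2 + m' i2 = 0)%N by rewrite -mnmDE mE mnm3E.
have [m0|m0] := leqP n (m i0).
  left; have m0n : m i0 = n by lia.
  rewrite m0n divnn n_gt0 in k1.
  by split; [lia|apply: mnm3P; rewrite !mnm3E; lia].
have [m0'|m0'] := leqP n (m' i0).
  right; have m0n : m' i0 = n by lia.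
  rewrite m0n divnn n_gt0 in l1.
  by split; [lia|apply: mnm3P; rewrite !mnm3E; lia].
by rewrite !divn_small // in k1 l1; lia.
Qed.

Lemma generated_abc_ideal :
  generated_in_degree_le (symbolic_algebra abc_ideal) n.
Proof.
exists [set f | exists k c, [/\ (k <= n)%N, monomial_span (in_symbolic k) c
  & f = c *: 'X^k]]; split=> [f [k [c [kn _ ->]]]|]; first by exists k, c.
rewrite symbolic_algebraE; apply/seteqP; split; last first.
  apply: smallest_sub.
    by apply: graded_span_subalg; [apply: in_symbolic0|apply: in_symbolicD].
  by move=> _ [k [c [_ kc ->]]]; apply: graded_span_scaleXn.
move=> f fA B [Balg SB]; move: f fA; apply: graded_span_sub => // k.
elim/ltn_ind: k => k IHk m km; have [kn|nk] := leqP k n.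
  by apply: SB; exists k, 'X_[m]; split=> //; apply/monomial_spanX.
(* Both factors have degree below [k], since [0 < s <= n < k]. *)
have [s [m1 [m2 [/andP[s_gt0 sn] sm1 sm2 ->]]]] := in_symbolic_split nk km.
have -> : 'X_[m1 + m2] *: 'X^k =
    ('X_[m1] *: 'X^s) * ('X_[m2] *: 'X^(k - s)) :> {poly {mpoly K[3]}}.
  by rewrite -scalerAl -scalerAr scalerA -mpolyXD -exprD subnKC //; lia.
have [_ _ BM] := Balg; suff: forall f g, B f -> B g -> B (f * g).
  by apply; apply: IHk => //; lia.
by move=> f g Bf Bg; have := BM f g; rewrite !inE; apply.
Qed.

Lemma generated_abc_ideal_ge d :
  generated_in_degree_le (symbolic_algebra abc_ideal) d -> (n <= d)%N.
Proof.
rewrite symbolic_algebraE => -[S [Sd SE]]; rewrite leqNgt; apply/negP => dn.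
(* Only the term [a^n b^(n-1) t^n] is removed; [in_symbolic_mu_irreducible] keeps the rest closed
   under products. *)
pose Q k m := in_symbolic k m && ((k, m) != (n, mu)).
have Q0 m : Q 0%N m by rewrite /Q /= xpair_eqE; lia.
have QD k l m m' : Q k m -> Q l m' -> Q (k + l)%N (m + m')%MM.
  move=> /andP[km nm] /andP[lm' nm']; rewrite /Q in_symbolicD //=.
  rewrite xpair_eqE; apply/andP => -[/eqP kl /eqP mm'].
  have [[kn mn]|[ln mn]] := in_symbolic_mu_irreducible km lm' kl mm'.
    by rewrite kn mn eqxx in nm.
  by rewrite ln mn eqxx in nm'.
(* The generators have degree at most [d < n], so the removed term occurs in none of them. *)
have AQ : graded_span (K := K) in_symbolic `<=` graded_span Q.
  rewrite {1}SE; apply: smallest_sub; first exact: graded_span_subalg.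
  move=> f Sf; have [k [c [kd fE]]] := Sd _ Sf.
  rewrite fE; apply: graded_span_scaleXn => m mc.
  have : graded_span in_symbolic f by rewrite SE; apply: sub_gen_smallest.
  rewrite fE => /(_ k); rewrite coefZ coefXn eqxx mulr1 => /(_ m mc) km.
  by rewrite /Q unfold_in; apply/andP; split=> //; rewrite xpair_eqE; lia.
have : graded_span Q ('X_[mu] *: 'X^n : {poly {mpoly K[3]}}).
  by apply/AQ/graded_span_scaleXn/monomial_spanX/in_symbolic_mu.
move=> /(_ n); rewrite coefZ coefXn eqxx mulr1 => /monomial_spanX.
by rewrite /Q eqxx andbF.
Qed.

Lemma generation_degree_abc_ideal :
  generation_degree (symbolic_algebra abc_ideal) n.
Proof. by split; [exact: generated_abc_ideal|exact: generated_abc_ideal_ge]. Qed.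

End Ideal.

End TwoComponents.

Arguments abc_ideal K n : clear implicits.

(** * Lengths of chains of primes *)

Section Height.
Variables (K : fieldType) (n : nat).
Implicit Types (s : pred 'I_n) (m : 'X_{1..n}) (f g : {mpoly K[n]}).

Definition in_vars s m := [exists i, s i && (0 < m i)%N].

Definition var_ideal s : set {mpoly K[n]} := monomial_span (in_vars s).

Lemma in_vars_up s : up_closed (in_vars s).
Proof.
move=> m m' /existsP[i /andP[si mi]]; apply/existsP; exists i.
by rewrite si mnmDE addn_gt0 mi orbT.
Qed.

(** A ring endomorphism of a domain with kernel [var_ideal s], which is therefore prime. *)
Definition kill_vars s f : {mpoly K[n]} :=
  f \mPo [tuple if s i then 0 else 'X_i | i < n].

Lemma kill_varsE s f m : (kill_vars s f)@_m = if in_vars s m then 0 else f@_m.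
Proof.
have killX m' : kill_vars s 'X_[m'] = if in_vars s m' then 0 else 'X_[m'].
  rewrite /kill_vars comp_mpolyX; case: ifPn => [/existsP[i /andP[si mi]]|].
    by rewrite (bigD1 i) //= tnth_mktuple si expr0n eqn0Ngt mi mul0r.
  rewrite negb_exists => /forallP sm; rewrite mpolyXE_id; apply: eq_bigr => i _.
  rewrite tnth_mktuple; case: ifPn (sm i) => //= _.
  by rewrite -eqn0Ngt => /eqP->; rewrite !expr0.
have -> : kill_vars s f =
    \sum_(m' <- msupp f) f@_m' *: (if in_vars s m' then 0 else 'X_[m']).
  rewrite {1}[f]mpolyE /kill_vars raddf_sum; apply: eq_bigr => m' _ /=.
  by rewrite comp_mpolyZ -killX.
have fE : f@_m = \sum_(m' <- msupp f) f@_m' * (m' == m)%:R.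
  rewrite {1}[f]mpolyE raddf_sum; apply: eq_bigr => m' _ /=.
  by rewrite mcoeffZ mcoeffX.
rewrite fE raddf_sum; case: ifPn => sm.
  apply: big1 => m' _ /=; rewrite mcoeffZ.
  case: ifPn => sm'; first by rewrite mcoeff0 mulr0.
  rewrite mcoeffX; case: eqP => [mE|_]; last by rewrite mulr0.
  by rewrite mE sm in sm'.
apply: eq_bigr => m' _ /=; rewrite mcoeffZ.
case: ifPn => sm'; rewrite ?mcoeffX //.
by case: eqP => [mE|_]; rewrite mcoeff0 // -mE sm' in sm *.
Qed.

Lemma kill_vars_eq0 s f : kill_vars s f = 0 <-> var_ideal s f.
Proof.
split=> [f0 m mf|fs].
  apply: contraTT mf => sm; rewrite -mcoeff_eq0.
  by have := kill_varsE s f m;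
    rewrite f0 mcoeff0 (negbTE (sm : ~~ in_vars s m)) => <-.
apply/mpolyP => m; rewrite kill_varsE mcoeff0; case: ifPn => // sm.
by apply/eqP; rewrite mcoeff_eq0; apply: contra sm => /fs.
Qed.

Lemma var_ideal_prime s : prime_ideal (var_ideal s).
Proof.
apply: prime_idealP; first exact/monomial_span_ideal/in_vars_up.
  move=> /kill_vars_eq0; rewrite /kill_vars comp_mpoly1.
  by apply/eqP; rewrite oner_eq0.
move=> f g /kill_vars_eq0; rewrite /kill_vars rmorphM /= => /eqP.
by rewrite mulf_eq0 => /orP[]/eqP/kill_vars_eq0; [left|right].
Qed.

Lemma var_idealX s i : var_ideal s 'X_i <-> s i.
Proof.
split=> [/monomial_spanX/existsP[j]|si].
  by rewrite mnm1E; case: eqVneq => [->|_] /andP[].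
by apply/monomial_spanX/existsP; exists i; rewrite si mnm1E eqxx.
Qed.

Lemma var_ideal_sub s (J : set {mpoly K[n]}) :
  is_ideal J -> (forall i, s i -> J 'X_i) -> var_ideal s `<=` J.
Proof.
move=> idJ sJ; apply: monomial_span_sub => // m /existsP[i /andP[si mi]].
have /submK <- : (U_(i) <= m)%MM by rewrite lep1mP -lt0n.
by rewrite mpolyXD; apply: is_idealMl => //; apply: sJ.
Qed.

Lemma card_bmultinom d : (#|{: 'X_{1..n < d}}| <= d ^ n)%N.
Proof.
have lt_d (m : 'X_{1..n < d}) i : (m i < d)%N.
  by apply: leq_ltn_trans (bmdeg m); rewrite mdegE (bigD1 i) //= leq_addr.
have <- : #|{: {ffun 'I_n -> 'I_d}}| = (d ^ n)%N by rewrite card_ffun !card_ord.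
pose F (m : 'X_{1..n < d}) : {ffun 'I_n -> 'I_d} :=
  [ffun i => Ordinal (lt_d m i)].
suff /leq_card : injective F by [].
move=> m m' /ffunP mm'.
apply/val_inj/mnmP => i; have := congr1 val (mm' i).
by rewrite !ffunE.
Qed.

(** [msize] at most [d] means degree below [d]. The coefficient matrix has a row for each [t] and at
    most [d^n] columns, so its left kernel is nonzero. *)
Lemma linear_dependence (T : finType) (y : T -> {mpoly K[n]}) d :
    (forall t, (msize (y t) <= d)%N) -> (d ^ n < #|T|)%N ->
  exists v : T -> K, (exists t, v t != 0) /\ \sum_t v t *: y t = 0.
Proof.
move=> yd dT; pose U := 'X_{1..n < d} : finType.
pose A := \matrix_(i < #|T|, j < #|U|) (y (enum_val i))@_(enum_val j : U).
have : kermx A != 0.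
  rewrite kermx_eq0 -row_leq_rank -ltnNge.
  apply: leq_ltn_trans (rank_leq_col _) _.
  exact: leq_ltn_trans (card_bmultinom d) dT.
move=> /rowV0Pn[v /sub_kermxP vA v0].
exists (fun t => v 0 (enum_rank t)); split.
  have [j vj] : exists j, v 0 j != 0.
    apply: contrapT => vj; move/eqP: v0; apply; apply/rowP => j; rewrite mxE.
    by apply/eqP; apply: contrapT => /negP vj0; apply: vj; exists j.
  by exists (enum_val j); rewrite enum_valK.
apply/mpolyP => m; rewrite mcoeff0 raddf_sum /=.
have [md|md] := ltnP (mdeg m) d; last first.
  rewrite big1 // => t _; rewrite mcoeffZ (memN_msupp_eq0 (m := m)) ?mulr0 //.
  by apply: msize_mdeg_ge; apply: leq_trans (yd t) md.
have := congr1 (fun B : 'rV_(#|U|) => B 0 (enum_rank (BMultinom md : U))) vA.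
rewrite !mxE => {2}<-; rewrite (reindex (@enum_val T predT)) /=; last first.
  by exists enum_rank => t _; rewrite ?enum_valK ?enum_rankK.
by apply: eq_bigr => i _; rewrite mcoeffZ mxE enum_valK enum_rankK.
Qed.

(* The coefficients of lowest degree in x vanish first: they lie in p' because
   x does, and a factor x can be cancelled because p is prime and x is not in p. *)
Lemma independent_mod_step (p p' : set {mpoly K[n]}) x D (T : finType)
    (y : T -> {mpoly K[n]}) :
    prime_ideal p -> is_ideal p' -> p `<=` p' -> p' x -> ~ p x ->
    (forall v : T -> K, p' (\sum_t v t *: y t) -> forall t, v t = 0) ->
  forall v : T -> nat -> K,
    p (\sum_(i < D) \sum_t v t i *: (y t * x ^+ i)) ->
    forall t i, (i < D)%N -> v t i = 0.
Proof.
move=> pp idp' pp' p'x px yI; elim: D => [//|D IHD] v.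
rewrite big_ord_recl /=; under eq_bigr => t _ do rewrite expr0 mulr1.
have -> : \sum_(i < D) \sum_t v t (bump 0 i) *: (y t * x ^+ bump 0 i) =
    x * \sum_(i < D) \sum_t v t i.+1 *: (y t * x ^+ i).
  rewrite mulr_sumr; apply: eq_bigr => i _; rewrite mulr_sumr.
  by apply: eq_bigr => t _; rewrite -scalerAr exprS mulrCA.
set z := \sum_(i < D) _ => pv; have v0 : forall t, v t 0%N = 0.
  apply: (yI (v^~ 0%N)); rewrite -[X in p' X](addrK (x * z)).
  apply: is_idealD => //; first exact: pp'.
  by rewrite -mulrN mulrC; apply: is_idealMl.
move: pv; rewrite big1 ?add0r => [|t _]; last by rewrite v0 scale0r.
move=> /(prime_idealM pp)[//|/(IHD (fun t i => v t i.+1)) vS] t [|i] iD //.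
exact: vS.
Qed.

(** The family consists of the products of powers of [x 0], ..., [x (h - 1)] with all exponents
    below [D]. By induction the shifted chain gives a family independent modulo [p 1], and
    [independent_mod_step] adjoins the powers of [x 0]. *)
Lemma prime_chain_independent h D d (p : nat -> set {mpoly K[n]})
    (x : nat -> {mpoly K[n]}) :
    (forall i, (i <= h)%N -> prime_ideal (p i)) ->
    (forall i, (i < h)%N ->
       [/\ p i `<=` p i.+1, p i.+1 (x i), ~ p i (x i) & (msize (x i) < d)%N]) ->
  exists (T : finType) (y : T -> {mpoly K[n]}),
    [/\ #|T| = (D ^ h)%N, forall t, (msize (y t) <= (h * D * d).+1)%N
      & forall v : T -> K, p 0%N (\sum_t v t *: y t) -> forall t, v t = 0].
Proof.
elim: h p x => [|h IHh] p x pp px.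
  exists unit, (fun=> 1); split=> [|t|v pv []]; rewrite ?card_unit ?msize1 //.
  apply: contrapT => /eqP vt; apply: (prime_ideal1 (pp 0%N isT)).
  have idp := prime_is_ideal (pp 0%N isT).
  have := is_idealMl (v tt)^-1%:MP idp pv.
  by rewrite (big_pred1 tt) => [|[]//];
    rewrite mul_mpolyC scalerA mulVf ?scale1r.
have [T [y [cardT yd yI]]] := IHh (fun i => p i.+1) (fun i => x i.+1)
  (fun i => pp i.+1) (fun i => px i.+1).
have [p01 p1x p0x xd] := px 0%N isT.
exists ('I_D * T)%type, (fun t : 'I_D * T => y t.2 * x 0%N ^+ t.1); split.
- by rewrite card_prod card_ord cardT expnS.
- case=> i t /=.
  have : (msize (y t * x 0%N ^+ i) <= msize (y t) + i * d)%N.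
    elim: (i : nat) => [|j IHj]; first by rewrite expr0 mulr1 leq_addr.
    rewrite exprSr mulrA; apply: leq_trans (msizeM_le _ _) _.
    by rewrite mulSnr; lia.
  move=> /leq_trans; apply; have := yd t; have := ltn_ord i.
  move=> iD yt; have : (i * d <= D * d)%N by rewrite leq_mul2r ltnW ?orbT.
  by rewrite !mulSn mulnDl; lia.
move=> v pv; have idp1 := prime_is_ideal (pp 1%N isT).
(* There the coefficients are indexed by all naturals; [insub] extends [v] by zero from [D] on. *)
have vI := @independent_mod_step _ _ _ D _ _ (pp 0%N isT) idp1 p01 p1x p0x yI
  (fun t i => if insub i is Some j then v (j, t) else 0).
case=> i t; have := vI _ t i (ltn_ord i); rewrite valK; apply.
rewrite pair_bigA /= in pv *.
congr (p 0%N _): pv; apply: eq_bigr => -[j t'] _ /=.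
by rewrite valK.
Qed.

(** The first [n + 1] steps of a longer chain would give [D^(n+1)] independent polynomials of size
    at most [C * D], whereas at most [(C * D)^n] of them can be independent. *)
Lemma prime_chain_le (P : set {mpoly K[n]}) h :
  has_prime_chain P h -> (h <= n)%N.
Proof.
case=> p [pp plt _]; rewrite leqNgt; apply/negP => nh.
have ex i : exists xi, (i < h)%N -> p i.+1 xi /\ ~ p i xi.
  have [ih|//] := ltnP i h; last by exists 0.
  have [_ pN] := plt i ih; apply: contrapT => xN; apply: pN => z pz.
  by apply: contrapT => zN; apply: xN; exists z.
have [x xP] := choice ex.
pose d := (\max_(i < n.+1) msize (x i)).+1%N.
(* [C] is chosen so that [C * D] bounds the sizes, and [D > C^n] gives [(C * D)^n < D^(n+1)]. *)
pose C := (1 + n.+1 * d)%N; pose D := (C ^ n).+1.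
have [||T [y [cardT yd yI]]] := @prime_chain_independent n.+1 D d p x.
- by move=> i ih; apply: pp; apply: leq_trans ih nh.
- move=> i ih; have ih' := leq_trans ih nh; have [? ?] := xP i ih'.
  split=> //; first by case: (plt i ih').
  by rewrite ltnS; apply: (leq_bigmax (Ordinal ih)).
have le_CD : ((n.+1 * D * d).+1 <= C * D)%N.
  by rewrite /C mulnDl mul1n mulnAC /D; lia.
have [||v [[t vt] v0]] := @linear_dependence T y (C * D).
- by move=> t; apply: leq_trans (yd t) le_CD.
- by rewrite cardT expnMn expnS ltn_pmul2r // expn_gt0.
have := yI v; rewrite v0; have [p0 _] := prime_is_ideal (pp 0%N isT).
by move=> /(_ p0 t) /eqP; rewrite (negbTE vt).
Qed.

End Height.

Arguments var_ideal K {n} s.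

Section PrimeChains.
Variable R : comNzRingType.

Lemma has_prime_chain0 (P : set R) : prime_ideal P -> has_prime_chain P 0.
Proof. by move=> pP; exists (fun=> P); split. Qed.

Lemma has_prime_chainS (P P' : set R) h :
  has_prime_chain P h -> prime_ideal P' -> P `<` P' -> has_prime_chain P' h.+1.
Proof.
case=> p [pp plt ph] pP' PP'; exists (fun i => if (i <= h)%N then p i else P').
split=> [i _|i|]; last by rewrite ltnn.
  by case: ifP => // /pp.
rewrite ltnS => ih; rewrite ih; case: ltnP => [/plt//|hi].
by have -> : i = h; [apply/eqP; rewrite eqn_leq ih|rewrite ph].
Qed.

End PrimeChains.

(** * The height of the ideal *)

Section HeightTwo.
Variable K : fieldType.

Local Notation i0 := (@Ordinal 3 0 isT).
Local Notation i1 := (@Ordinal 3 1 isT).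
Local Notation i2 := (@Ordinal 3 2 isT).

Lemma var_ideal_proper n (s : pred 'I_n) (J : set {mpoly K[n]}) i :
    is_ideal J -> (forall j, s j -> J 'X_j) -> J 'X_i -> ~~ s i ->
  var_ideal K s `<` J.
Proof.
move=> idJ sJ Ji si; split; first exact: var_ideal_sub.
by move=> /(_ _ Ji)/var_idealX; apply/negP.
Qed.

Lemma abc_ideal_height n : ideal_height (abc_ideal K n.+1) 2.
Proof.
have gensI : [set 'X_i0 ^+ n.+1; 'X_i0 * 'X_i1; 'X_i1 * 'X_i2]
    `<=` abc_ideal K n.+1.
  exact: sub_ideal_gen.
(* Such a prime contains [a] and one of [b], [c], so it ends the chain formed by the zero ideal,
   [(a)] and [P]. *)
have chain2 P : prime_ideal P -> abc_ideal K n.+1 `<=` P -> has_prime_chain P 2.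
  move=> pP IP; have idP := prime_is_ideal pP.
  have Pa : P 'X_i0.
    by apply: (prime_idealX pP); apply: (IP _ (gensI _ _)); left; left.
  have [i [Pi i_neq0]] : exists i, P 'X_i /\ i != i0.
    have : P ('X_i1 * 'X_i2) by apply: (IP _ (gensI _ _)); right.
    by move=> /(prime_idealM pP)[Pi|Pi]; [exists i1|exists i2].
  apply: (has_prime_chainS (P := var_ideal K (pred1 i0))) => //; last first.
    by apply: (var_ideal_proper (i := i)) => // j /eqP->.
  apply: (has_prime_chainS (P := var_ideal K pred0)).
  - exact/has_prime_chain0/var_ideal_prime.
  - exact: var_ideal_prime.
  - apply: (var_ideal_proper (i := i0)) => //;
      last by apply/var_idealX; rewrite /= eqxx.
    exact/prime_is_ideal/var_ideal_prime.
split=> [|P k pP IP [_]]; last by apply; apply: chain2.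
(* The prime [(a, b)] attains the minimum. *)
pose s := [pred i : 'I_3 | i != i2].
have ps := @var_ideal_prime K 3 s; have ids := prime_is_ideal ps.
have Is : abc_ideal K n.+1 `<=` var_ideal K s.
  have Xs i : i != i2 -> var_ideal K s 'X_i by move=> ?; apply/var_idealX.
  apply: ideal_gen_sub => // _ [[|]|] ->.
  - by rewrite exprSr; apply: (is_idealMl _ ids); apply: Xs.
  - by apply: (is_idealMl _ ids); apply: Xs.
  - by apply: (is_idealMr _ ids); apply: Xs.
exists (var_ideal K s); split=> //; split=> [|k sk]; first exact: chain2.
have pT := @var_ideal_prime K 3 predT.
suff /prime_chain_le :
  has_prime_chain (var_ideal K (predT : pred 'I_3)) k.+1 by [].
apply: (has_prime_chainS sk) => //.
apply: (var_ideal_proper (i := i2)); first exact: prime_is_ideal.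
- by move=> j _; apply/var_idealX.
- by apply/var_idealX.
- by [].
Qed.

Lemma abc_ideal_monomial n : monomial_ideal (abc_ideal K n).
Proof.
exists [set mnm3 n 0 0; mnm3 1 1 0; mnm3 0 1 1].
rewrite /abc_ideal abc_ideal_gensE; congr ideal_gen; apply/seteqP; split=> f.
  by move=> [[|]|] ->; eexists=> //; [left; left|left; right|right].
by move=> [m [[|]|] -> ->]; [left; left|left; right|right].
Qed.

End HeightTwo.

Theorem mainTheorem4 :
  (forall n : nat, (1 <= n)%N ->
     let a : {mpoly rat[3]} := 'X_(@Ordinal 3 0 isT) in
     let b : {mpoly rat[3]} := 'X_(@Ordinal 3 1 isT) in
     let c : {mpoly rat[3]} := 'X_(@Ordinal 3 2 isT) in
     let I := ideal_gen [set a ^+ n; a * b; b * c] in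
     generation_degree (symbolic_algebra I) n)
  /\
  (forall N : nat, exists I : set {mpoly rat[3]},
     [/\ monomial_ideal I,
         ideal_height I 2
       & exists2 d : nat, (N <= d)%N & generation_degree (symbolic_algebra I) d]).
Proof.
split=> [n n_gt0 a b c I|N].
  exact: (generation_degree_abc_ideal rat n_gt0).
(* The successor keeps the exponent of [a] positive when [N = 0]. *)
exists (abc_ideal rat N.+1); split; first exact: abc_ideal_monomial.
  exact: abc_ideal_height.
by exists N.+1; [exact: leqnSn|exact: generation_degree_abc_ideal].
Qed.
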